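(* For every integer $k\geqslant 2$, there are positive constants $c$, $C$ and $n_0\in\mathbb{N}$ such that for every non-decreasing function $f:\mathbb{N}\to\mathbb{N}$ with $n\leqslant f(n)\leqslant R(K_n)$ for all $n$, there is a sequence of connected graphs $(G_n)_{n\in\mathbb{N}}$ with $|V(G_n)|=n$ such that $c f(n)\leqslant R(G_n)\leqslant C f(n)$ for all $n\in\mathbb{N}$. Moreover, $\chi(G_n)\geqslant k$ for every $n\geqslant n_0$.
   Context: For a graph $G$, the Ramsey number $R(G)$ is the smallest integer $N$ such that every two-colouring of the edges of the complete graph $K_N$ contains a monochromatic copy of $G$. $\chi(G)$ denotes the chromatic number of $G$. *)

(* Defs.v *)
From Stdlib Require Import Reals ClassicalEpsilon.
From mathcomp Require Import all_boot.

Set Implicit Arguments.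
Unset Strict Implicit.
Unset Printing Implicit Defensive.

Definition min_nat (P : pred nat) : nat :=
  match excluded_middle_informative (exists n, P n) with
  | left h => ex_minn h
  | right _ => 0
  end.

Definition simple_graph n (G : rel 'I_n) : Prop :=
  (forall u v, G u v = G v u) /\ (forall u, G u u = false).

Definition connected_graph n (G : rel 'I_n) : Prop :=
  forall u v, connect G u v.

Definition complete_graph n : rel 'I_n := fun u v => u != v.

Definition ramsey_arrow n (G : rel 'I_n) (N : nat) : bool :=
  [forall c : {ffun 'I_N -> {ffun 'I_N -> bool}},
     [forall x, forall y, c x y == c y x] ==>
     [exists phi : {ffun 'I_n -> 'I_N},
        injectiveb phi &&
        [exists b : bool, [forall u, forall v, G u v ==> (c (phi u) (phi v) == b)]]]].

Definition ramsey_number n (G : rel 'I_n) : nat := min_nat (ramsey_arrow G).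

Definition colourable n (G : rel 'I_n) (m : nat) : bool :=
  [exists col : {ffun 'I_n -> 'I_m}, [forall u, forall v, G u v ==> (col u != col v)]].

Definition chromatic_number n (G : rel 'I_n) : nat := min_nat (colourable G).
Arguments complete_graph n : clear implicits.

(* Main.v *)
Require Import Defs.
From Stdlib Require Import Reals ClassicalEpsilon.
From mathcomp Require Import all_boot.
From mathcomp Require Import zify.

Set Implicit Arguments.
Unset Strict Implicit.
Unset Printing Implicit Defensive.

(* Let G(t, n) be a clique on t of the n vertices, one of which is moreover
   joined to all others. Up to constant factors R(G(t, n)) is the maximum of
   R(K_t) and t n. Since R(K_(t+1)) = O(R(K_t)), increasing t by one changes
   R(G(t, n)) by a bounded factor only, so as t runs from k to n these numbers
   come within a constant factor of any value between n and R(K_n).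

   For R(K_(t+1)) = O(R(K_t)): in a colouring without monochromatic K_(t+1), a
   majority neighbourhood A of a vertex, say in red, has no red K_t, hence its
   blue degrees are less than R(K_t). If A is much larger than R(K_t), it is
   nearly red and thus (an argument in the spirit of Erdos and Szemeredi) of
   size at most 2^(ct) with small c, contradicting R(K_t) > 2^(t/2 - 1). *)

(** * Monochromatic cliques in a two-coloured complete graph *)

Section Cliques.
Variables (V : finType) (c : V -> V -> bool).
Hypothesis c_sym : forall x y, c x y = c y x.

(** A colouring is a total function on pairs whose diagonal values mean nothing; hence the guard
    [x != y] here and [x != v] in [nbhd]. *)
Definition mono b (S : {set V}) : Prop :=
  {in S &, forall x y, x != y -> c x y = b}.

Definition has_clique b (W : {set V}) m : Prop :=
  exists S : {set V}, [/\ S \subset W, m <= #|S| & mono b S].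

Definition nbhd b v (W : {set V}) : {set V} :=
  [set x in W | (x != v) && (c v x == b)].

Lemma has_cliqueS b (W W' : {set V}) m m' :
  W \subset W' -> m' <= m -> has_clique b W m -> has_clique b W' m'.
Proof.
move=> sW le_m [S [sS le_mS monoS]]; exists S; split=> //.
- exact: subset_trans sS sW.
- exact: leq_trans le_m le_mS.
Qed.

Lemma has_clique0 b W : has_clique b W 0.
Proof. by exists set0; split; rewrite ?sub0set // => x y; rewrite inE. Qed.

Lemma nbhdS b v (W W' : {set V}) :
  W \subset W' -> nbhd b v W \subset nbhd b v W'.
Proof.
by move=> /subsetP sW; apply/subsetP => x; rewrite !inE => /andP[/sW -> ->].
Qed.

Lemma nbhd_sub b v W : nbhd b v W \subset W.
Proof. by apply/subsetP => x; rewrite inE => /andP[]. Qed.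

Lemma mono_nbhdU b v S W : mono b S -> S \subset nbhd b v W -> mono b (v |: S).
Proof.
move=> monoS /subsetP sS.
have cv x : x \in S -> c v x = b by move/sS; rewrite inE => /and3P[_ _ /eqP].
move=> x y /setU1P[->|Sx] /setU1P[->|Sy] ne_xy; first by rewrite eqxx in ne_xy.
- exact: cv.
- by rewrite c_sym; apply: cv.
- exact: monoS.
Qed.

Lemma has_clique_nbhd b v (W : {set V}) m :
  v \in W -> has_clique b (nbhd b v W) m -> has_clique b W m.+1.
Proof.
move=> Wv [S [sS le_mS monoS]]; exists (v |: S); split.
- by rewrite subUset sub1set Wv (subset_trans sS) ?nbhd_sub.
- rewrite cardsU1; case: (boolP (v \in S)) => // /(subsetP sS).
  by rewrite inE eqxx andbF.
- exact: mono_nbhdU monoS sS.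
Qed.

Lemma card_nbhd b v (W : {set V}) :
  v \in W -> #|W| = (#|nbhd b v W| + #|nbhd (~~ b) v W|).+1.
Proof.
move=> Wv; rewrite (cardsD1 v W) Wv -(cardsID [set x | c v x == b] (W :\ v)).
rewrite add1n; congr (_ + _).+1; apply: eq_card => x; rewrite !inE.
  by rewrite andbA [(_ != _) && _]andbC.
by case: b (c v x) => -[]; rewrite ?andbF ?andbT //= andbC.
Qed.

(** By Pascal's rule, one of the two neighbourhoods of any vertex of [W] is large enough for the
    induction on [p + q]. *)
Lemma erdos_szekeres b p q (W : {set V}) :
  'C(p + q, p) <= #|W| -> has_clique b W p \/ has_clique (~~ b) W q.
Proof.
have [n] := ubnP (p + q); elim: n p q W => // n IHn [|p] [|q] W lt_pq le_W.
- by left; apply: has_clique0.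
- by left; apply: has_clique0.
- by right; apply: has_clique0.
have [v Wv] : exists v, v \in W.
  apply/set0Pn; rewrite -card_gt0; apply: leq_trans le_W.
  by rewrite bin_gt0; lia.
have := card_nbhd b Wv; rewrite addSn binS in le_W => cardW.
have [le_p|lt_p] := leqP 'C(p + q.+1, p) #|nbhd b v W|.
  have [||cl|cl] := IHn p q.+1 (nbhd b v W) => //.
    by left; apply: has_clique_nbhd Wv _.
  by right; apply: has_cliqueS cl => //; apply: nbhd_sub.
have [|| cl|cl] := IHn p.+1 q (nbhd (~~ b) v W); first by lia.
- by rewrite addSnnS; move: cardW le_W lt_p; lia.
- by left; apply: has_cliqueS cl => //; apply: nbhd_sub.
- by right; apply: has_clique_nbhd Wv _.
Qed.

(** Double counting: the [b]-coloured pairs between [A] and [T] are counted from the side of [T]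
    instead. *)
Lemma sum_nbhd b (A T : {set V}) d :
  T \subset A -> (forall x, x \in A -> #|nbhd b x A| <= d) ->
  \sum_(x in A) #|nbhd b x T| <= #|T| * d.
Proof.
move=> /subsetP sTA deg.
have -> : \sum_(x in A) #|nbhd b x T| = \sum_(y in T) #|nbhd b y A|.
  transitivity (\sum_(x in A) \sum_(y in T | (y != x) && (c x y == b)) 1).
    by apply: eq_bigr => x _; rewrite -sum1_card; apply: eq_bigl => y; rewrite inE.
  rewrite (exchange_big_dep (mem T)) /=; last by move=> x y _ /andP[].
  apply: eq_bigr => y Ty; rewrite -sum1_card; apply: eq_bigl => x.
  by rewrite !inE Ty /= eq_sym c_sym.
rewrite -sum_nat_const; apply: leq_sum => y /sTA; exact: deg.
Qed.

(** Vandermonde's identity writes ['C(t + s, s)] as a sum of terms ['C(t, i) * 'C(s, s - i)], each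
    at least the number of subsets of size [i]. *)
Lemma card_small_subsets (T : {set V}) t s :
  #|T| <= t -> #|[set B : {set V} | (B \subset T) && (#|B| < s)]| <= 'C(t + s, s).
Proof.
move=> le_Tt; set P := [set B | _].
apply: (@leq_trans (\sum_(i < s.+1) #|[set B : {set V} | (B \subset T) && (#|B| == i)]|)).
  have sP : P \subset \bigcup_(i < s.+1) [set B : {set V} | (B \subset T) && (#|B| == i)].
    apply/subsetP => B; rewrite inE => /andP[sB lt_B].
    have lt_B' : #|B| < s.+1 by lia.
    by apply/bigcupP; exists (Ordinal lt_B'); rewrite // inE sB eqxx.
  apply: leq_trans (subset_leq_card sP) _.
  elim/big_rec2: _ => [|i m U _ le_U]; first by rewrite cards0.
  by apply: leq_trans (leq_card_setU _ _) _; rewrite leq_add2l.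
rewrite -Vandermonde; apply: leq_sum => i _.
rewrite cards_draws; apply: leq_trans (leq_bin2l _ le_Tt) _.
by rewrite leq_pmulr // bin_gt0 leq_subr.
Qed.

(* A b-clique T with fewer than t vertices is enlarged: many vertices send the
   same small set B of (~~ b)-edges to T, and a b-clique larger than B found
   among them can replace B. *)
Lemma card_sparse_colour b (A : {set V}) t d s :
  (forall x, x \in A -> #|nbhd (~~ b) x A| <= d) ->
  ~ has_clique b A t -> ~ has_clique (~~ b) A t.+1 ->
  0 < s -> 2 * t * d <= s * #|A| ->
  #|A| <= 2 * (t + 'C(t + s, s) * 'C(s + t.+1, s)).
Proof.
move=> deg no_b no_nb s_gt0 le_d; rewrite leqNgt; apply/negP => lt_A.
suff grow m : has_clique b A m by apply: no_b.
elim: m => [|m [T [sT le_mT monoT]]]; first exact: has_clique0.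
have lt_Tt : #|T| < t.
  by rewrite ltnNge; apply/negP => le_tT; apply: no_b; exists T.
(* By double counting, [s * #|bad| <= #|T| * d], so the hypothesis on [2 * t * d] leaves at least
   half of [A] outside [bad]. *)
pose bad := [set x in A | s <= #|nbhd (~~ b) x T|].
have card_bad : 2 * #|bad| <= #|A|.
  have le_bad : s * #|bad| <= #|T| * d.
    apply: leq_trans (sum_nbhd sT deg).
    rewrite mulnC -sum_nat_const [leqRHS](big_setID bad) /=.
    apply: leq_trans (leq_addr _ _).
    have -> : A :&: bad = bad by apply/setIidPr/subsetP => x; rewrite inE => /andP[].
    by apply: leq_sum => x; rewrite inE => /andP[].
  have le_Td := leq_mul (ltnW lt_Tt) (leqnn d).
  by rewrite -(leq_pmul2l s_gt0); lia.
pose D := (A :\: bad) :\: T.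
have card_D : 'C(t + s, s) * 'C(s + t.+1, s) < #|D|.
  have := cardsID bad A; have := cardsID T (A :\: bad).
  have := subset_leq_card (subsetIr A bad).
  have := subset_leq_card (subsetIr (A :\: bad) T).
  by rewrite -/D; lia.
pose P := [set B : {set V} | (B \subset T) && (#|B| < s)].
pose fib B := [set x in D | nbhd (~~ b) x T == B].
(* Pigeonhole: the vertices of [D] are sorted by their [(~~ b)]-neighbourhood in [T], for which
   there are at most ['C(t + s, s)] possibilities. *)
have [B PB le_fib] : exists2 B, B \in P & 'C(s + t.+1, s) <= #|fib B|.
  apply/exists_inP; apply: contraLR card_D; rewrite negb_exists_in -leqNgt.
  move=> /forall_inP small.
  apply: leq_trans (leq_mul (card_small_subsets s (ltnW lt_Tt)) (leqnn _)).
  rewrite -/P -sum_nat_const -sum1_card.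
  rewrite (partition_big (fun x => nbhd (~~ b) x T) (mem P)) /=; last first.
    move=> x; rewrite !inE nbhd_sub => /and3P[_ + Ax].
    by rewrite Ax -ltnNge.
  apply: leq_sum => B /small; rewrite -ltnNge => /ltnW.
  apply: leq_trans; rewrite -sum1_card; apply: eq_leq.
  by apply: eq_bigl => x; rewrite [in RHS]inE.
have sfA : fib B \subset A.
  by apply/subsetP => x; rewrite !inE => /andP[/and3P[]].
(* A [(~~ b)]-clique of size [t + 1] is excluded, so the fibre holds a [b]-clique [Q] with
   [#|B| < s <= #|Q|]; trading [B] for [Q] enlarges [T]. *)
have [[Q [sQ le_sQ monoQ]]|cl] := erdos_szekeres b le_fib; last first.
  by case: no_nb; apply: has_cliqueS cl.
have QP x : x \in Q -> [/\ x \in A, x \notin T & nbhd (~~ b) x T = B].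
  by move=> /(subsetP sQ); rewrite !inE => /andP[/and3P[-> _ ->] /eqP].
have cross x y : x \in T :\: B -> y \in Q -> c y x = b.
  rewrite inE => /andP[nBx Tx] /QP[_ nTy defB]; apply: contraNeq nBx.
  rewrite -{}defB inE Tx => ne_cb /=; apply/andP; split.
    by apply: contraNneq nTy => <-.
  by case: (b) (c y x) ne_cb => -[].
exists ((T :\: B) :|: Q); split.
- rewrite subUset (subset_trans (subsetDl _ _) sT).
  exact: subset_trans sQ sfA.
- move: PB; rewrite inE => /andP[sBT lt_Bs].
  rewrite cardsU; have -> : (T :\: B) :&: Q = set0.
    apply/setP => x; rewrite !inE; apply/negP => /andP[/andP[_ Tx] /QP[_]].
    by rewrite Tx.
  have := cardsID B T; have := subset_leq_card (subsetIr T B).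
  by rewrite cards0; lia.
- move=> x y /setUP[Tx|Qx] /setUP[Ty|Qy] ne_xy.
  + by move: Tx Ty; rewrite !inE => /andP[_ Tx] /andP[_ Ty]; apply: monoT.
  + by rewrite c_sym; apply: cross.
  + exact: cross.
  + exact: monoQ.
Qed.

End Cliques.

(** * Basic properties of the arrow relation and of Ramsey numbers *)

Lemma min_natP (P : pred nat) n : P n -> P (min_nat P) /\ min_nat P <= n.
Proof.
move=> Pn; rewrite /min_nat; case: excluded_middle_informative => [ex|[]].
  by case: ex_minnP => m Pm min_m; split; last apply: min_m.
by exists n.
Qed.

Lemma widen_ord_inj m n (le_mn : m <= n) : injective (widen_ord le_mn).
Proof. by move=> i j /(congr1 val) /= ?; apply: val_inj. Qed.

Lemma ramsey_arrowP n (G : rel 'I_n) N :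
  reflect (forall c : 'I_N -> 'I_N -> bool, (forall x y, c x y = c y x) ->
            exists phi : 'I_n -> 'I_N, injective phi /\
              exists b, forall u v, G u v -> c (phi u) (phi v) = b)
          (ramsey_arrow G N).
Proof.
apply: (iffP forallP) => [arrow c c_sym | arrow c].
  pose cf := [ffun x => [ffun y => c x y]].
  have cf_sym : [forall x, forall y, cf x y == cf y x].
    by apply/forallP => x; apply/forallP => y; rewrite !ffunE c_sym.
  have /existsP[phi] := implyP (arrow cf) cf_sym.
  case/andP=> /injectiveP inj_phi /existsP[b /forallP mono_phi].
  exists phi; split=> //; exists b => u v Guv.
  by move/forallP/(_ v): (mono_phi u); rewrite Guv !ffunE => /eqP.
apply/implyP => c_sym.
have [x y|phi [inj_phi [b mono_phi]]] := arrow (fun x y => c x y).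
  exact/eqP/(forallP (forallP c_sym x)).
apply/existsP; exists (finfun phi); apply/andP; split.
  by apply/injectiveP => u v; rewrite !ffunE => /inj_phi.
apply/existsP; exists b; apply/forallP => u; apply/forallP => v.
by apply/implyP => Guv; rewrite !ffunE mono_phi.
Qed.

Lemma ramsey_arrow_sub n m (G : rel 'I_n) (H : rel 'I_m) (h : 'I_m -> 'I_n) N :
  injective h -> (forall u v, H u v -> G (h u) (h v)) ->
  ramsey_arrow G N -> ramsey_arrow H N.
Proof.
move=> inj_h hom_h /ramsey_arrowP arrow; apply/ramsey_arrowP => c c_sym.
have [phi [inj_phi [b mono_phi]]] := arrow c c_sym.
exists (phi \o h); split; first exact: inj_comp.
by exists b => u v /hom_h; apply: mono_phi.
Qed.

Lemma ramsey_arrowW n (G : rel 'I_n) N N' :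
  N <= N' -> ramsey_arrow G N -> ramsey_arrow G N'.
Proof.
move=> le_N /ramsey_arrowP arrow; apply/ramsey_arrowP => c c_sym.
pose w := widen_ord le_N.
have [//|phi [inj_phi mono_phi]] := arrow (fun x y => c (w x) (w y)).
exists (w \o phi); split=> //; apply: inj_comp inj_phi; exact: widen_ord_inj.
Qed.

(** Enumerating [N] elements of [W] transports the arrow relation from ['I_N] to subsets of any
    finite type. *)
Lemma has_clique_arrow t N (V : finType) (c : V -> V -> bool) (W : {set V}) :
  ramsey_arrow (complete_graph t) N -> (forall x y, c x y = c y x) ->
  N <= #|W| -> exists b, has_clique c b W t.
Proof.
move=> /ramsey_arrowP arrow c_sym le_N.
pose w i := enum_val (widen_ord le_N i).
have inj_w : injective w.
  by move=> i j /enum_val_inj /widen_ord_inj.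
have [//|phi [inj_phi [b mono_phi]]] := arrow (fun x y => c (w x) (w y)).
exists b, [set w (phi i) | i : 'I_t]; split.
- by apply/subsetP => _ /imsetP[i _ ->]; apply: enum_valP.
- by rewrite card_imset ?cardsT ?card_ord //; apply: inj_comp inj_phi.
- move=> _ _ /imsetP[i _ ->] /imsetP[j _ ->] ne_ij; apply: mono_phi.
  by apply: contraNneq ne_ij => ->.
Qed.

Lemma arrow_has_clique t N :
  (forall c : 'I_N -> 'I_N -> bool, (forall x y, c x y = c y x) ->
     exists b, has_clique c b setT t) ->
  ramsey_arrow (complete_graph t) N.
Proof.
move=> clq; apply/ramsey_arrowP => c /clq[b [S [_ le_tS monoS]]].
exists (fun i => enum_val (widen_ord le_tS i)); split.
  by move=> i j /enum_val_inj /widen_ord_inj.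
exists b => u v ne_uv; apply: monoS; try exact: enum_valP.
by apply: contraNneq ne_uv => /enum_val_inj /widen_ord_inj ->.
Qed.

Lemma simple_graph_arrow n (G : rel 'I_n) N :
  simple_graph G -> ramsey_arrow (complete_graph n) N -> ramsey_arrow G N.
Proof.
move=> [_ G_irr]; apply: (@ramsey_arrow_sub _ _ _ _ id) => // u v Guv.
by apply: contraTneq Guv => ->; rewrite G_irr.
Qed.

(** The Erdos-Szekeres bound shows that some [N] qualifies, so [min_nat] does not fall back on its
    default value 0. *)
Lemma ramsey_numberP n (G : rel 'I_n) :
  simple_graph G -> ramsey_arrow G (ramsey_number G).
Proof.
move=> G_simple.
suff: ramsey_arrow G 'C(n + n, n) by case/min_natP.
apply: simple_graph_arrow => //; apply: arrow_has_clique => c c_sym.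
have [|cl|cl] := @erdos_szekeres _ c c_sym true n n setT.
- by rewrite cardsT card_ord.
- by exists true.
- by exists false.
Qed.

Lemma ramsey_number_le n (G : rel 'I_n) N :
  ramsey_arrow G N -> ramsey_number G <= N.
Proof. by case/min_natP. Qed.

Lemma ramsey_number_gt n (G : rel 'I_n) N :
  simple_graph G -> ~~ ramsey_arrow G N -> N < ramsey_number G.
Proof.
move=> /ramsey_numberP arrow; rewrite ltnNge; apply: contraNN => le_N.
exact: ramsey_arrowW le_N arrow.
Qed.

Lemma simple_complete n : simple_graph (complete_graph n).
Proof. by split=> [u v|u]; rewrite /complete_graph ?eqxx // eq_sym. Qed.

Lemma ramsey_complete_mono m n :
  m <= n -> ramsey_number (complete_graph m) <= ramsey_number (complete_graph n).
Proof.
move=> le_mn; apply: ramsey_number_le.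
have inj_w := @widen_ord_inj _ _ le_mn.
apply: (ramsey_arrow_sub inj_w _ (ramsey_numberP (simple_complete n))) => u v.
by rewrite /complete_graph (inj_eq inj_w).
Qed.

Lemma ramsey_complete_ge n : n <= ramsey_number (complete_graph n).
Proof.
have /ramsey_arrowP/(_ (fun _ _ => true))[//|phi [inj_phi _]] :=
  ramsey_numberP (simple_complete n).
by have := leq_card phi inj_phi; rewrite !card_ord.
Qed.

(** * The exponential lower bound for [R(K_t)] *)

Lemma card_const_ffun (E : finType) (S : {set E}) (b : bool) :
  #|[set f : {ffun E -> bool} | [forall x in S, f x == b]]| = 2 ^ (#|E| - #|S|).
Proof.
pose F x := if x \in S then pred1 b else predT.
have -> : #|[set f : {ffun E -> bool} | [forall x in S, f x == b]]| = #|family F|.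
  apply: eq_card => f; rewrite inE; apply/forall_inP/familyP => fP x.
    by rewrite /F; case: ifP => // /fP.
  by move=> Sx; have := fP x; rewrite /F Sx.
rewrite card_family foldrE big_map big_enum /= (bigID (mem S)) /=.
rewrite big1 => [|x Sx]; last by rewrite /F Sx card1.
rewrite mul1n (eq_bigr (fun=> 2)) => [|x /negPf nSx]; last first.
  by rewrite /F nSx; apply: card_bool.
by rewrite prod_nat_const -(cardC (mem S)) addKn.
Qed.

(** Union bound: each member of [P] is monochromatic under at most [2 * 2 ^ (#|E| - m)] of the
    [2 ^ #|E|] colourings. *)
Lemma property_B (E : finType) (P : {set {set E}}) m :
  (forall S, S \in P -> m <= #|S|) -> 2 * #|P| < 2 ^ m ->
  exists f : {ffun E -> bool}, forall S b, S \in P -> exists2 x, x \in S & f x != b.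
Proof.
move=> le_mP lt_P.
pose bad (S : {set E}) b := [set f : {ffun E -> bool} | [forall x in S, f x == b]].
have card_bad : #|\bigcup_(S in P) (bad S true :|: bad S false)| < 2 ^ #|E|.
  (* A member of [P] is needed to get [m <= #|E|], without which the subtraction in the exponent
     would be truncated. *)
  have [/cards0_eq P0 | P_gt0] := posnP #|P|.
    by rewrite P0 big_set0 cards0 expn_gt0.
  have [S0 PS0] : exists S, S \in P by apply/set0Pn; rewrite -card_gt0.
  have le_mE : m <= #|E| := leq_trans (le_mP _ PS0) (max_card _).
  apply: (@leq_ltn_trans (\sum_(S in P) 2 * 2 ^ (#|E| - m))).
    apply: (@leq_trans (\sum_(S in P) #|bad S true :|: bad S false|)).
      elim/big_rec2: _ => [|S k U _ le_U]; first by rewrite cards0.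
      by apply: leq_trans (leq_card_setU _ _) _; rewrite leq_add2l.
    apply: leq_sum => S PS; apply: leq_trans (leq_card_setU _ _) _.
    rewrite !card_const_ffun addnn -mul2n leq_mul2l leq_exp2l //.
    by rewrite leq_sub2l ?le_mP.
  rewrite sum_nat_const mulnA [_ * 2]mulnC -{2}(subnKC le_mE) expnD.
  by rewrite ltn_pmul2r ?expn_gt0.
have [f nf] : exists f, f \notin \bigcup_(S in P) (bad S true :|: bad S false).
  apply/existsP; apply: contraLR card_bad; rewrite negb_exists -leqNgt.
  move=> /forallP all_bad; rewrite -{1}card_bool -card_ffun.
  by apply: subset_leq_card; apply/subsetP => f _; have := all_bad f; rewrite negbK.
exists f => S b PS; apply/exists_inP; apply: contraNT nf.
rewrite negb_exists_in => /forall_inP fS; apply/bigcupP; exists S => //.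
have: f \in bad S b by rewrite inE; apply/forall_inP => x /fS; rewrite negbK.
by rewrite in_setU; case: b {fS} => ->; rewrite ?orbT.
Qed.

Lemma bin_le_expn n k : 'C(n, k) <= n ^ k.
Proof.
elim: n k => [|n IHn] [|k]; rewrite ?bin0 //.
rewrite binS; apply: leq_trans (leq_add (IHn _) (IHn _)) _.
rewrite [n.+1 ^ _]expnS expnS -mulSnr.
by rewrite leq_mul //; case: k => // k; rewrite leq_exp2r.
Qed.

(** Erdos's lower bound: [property_B] is applied to the hypergraph whose vertices are the edges of a
    complete graph and whose hyperedges are the edge sets of its [t]-cliques. *)
Lemma ramsey_complete_gt_expn m :
  0 < m -> 2 ^ m < ramsey_number (complete_graph (2 * m).+2).
Proof.
move=> m_gt0; apply: ramsey_number_gt; first exact: simple_complete.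
set N := 2 ^ m; set t := (2 * m).+2.
pose pairs (T : {set 'I_N}) := [set A : {set 'I_N} | (A \subset T) && (#|A| == 2)].
pose P := pairs @: [set T : {set 'I_N} | #|T| == t].
have [||f fP] := @property_B _ P 'C(t, 2).
- by move=> _ /imsetP[T + ->]; rewrite inE => /eqP <-; rewrite cards_draws.
- apply: (@leq_ltn_trans (2 * N ^ t)).
    rewrite leq_mul2l /=; apply: leq_trans (leq_imset_card _ _) _.
    by rewrite card_draws card_ord bin_le_expn.
  (* The exponents to compare are [m * t + 1 = 2 * m ^ 2 + 2 * m + 1] and
     ['C(t, 2) = 2 * m ^ 2 + 3 * m + 1]. *)
  rewrite -expnM -expnS ltn_exp2l // bin2 /t /= mulSn.
  by nia.
apply/negP => arrow; pose c (x y : 'I_N) := f [set x; y].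
have [||b [S [_ le_tS monoS]]] := @has_clique_arrow t N _ c setT arrow.
- by move=> x y; rewrite /c setUC.
- by rewrite cardsT card_ord.
have [T sTS cardT] : exists2 T : {set 'I_N}, T \subset S & #|T| = t.
  have : 0 < #|[set T : {set 'I_N} | (T \subset S) && (#|T| == t)]|.
    by rewrite cards_draws bin_gt0.
  by rewrite card_gt0 => /set0Pn[T]; rewrite inE => /andP[sT /eqP]; exists T.
have [|A] := fP (pairs T) b; first by apply: imset_f; rewrite inE cardT.
rewrite inE => /andP[sA /cards2P[x [y [ne_xy defA]]]] /negP[].
rewrite defA; apply/eqP/monoS => //;
  by apply/(subsetP sTS)/(subsetP sA); rewrite defA !inE eqxx ?orbT.
Qed.

(** * Estimates for binomial coefficients *)

(** A division-free form of [(1 + 1/q)^p <= 1 / (1 - p/q)], a variant of Bernoulli's inequality. *)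
Lemma expnS_le_mul q p : p <= q -> q.+1 ^ p * (q - p) <= q ^ p.+1.
Proof.
elim: p => [|p IHp] lt_pq; first by rewrite expn0 expn1 mul1n subn0.
rewrite [leqRHS]expnS; apply: leq_trans (leq_mul (leqnn q) (IHp (ltnW lt_pq))).
rewrite -(subnSK lt_pq) expnS.
have := leq_mul (leqnn (q.+1 ^ p)) (leq_subr p.+1 q); lia.
Qed.

(** Each block of [j] factors [1 + 1/q] contributes at most [1 / (1 - j/q) <= 2], and so does the
    incomplete last block. *)
Lemma expnS_le_exp2 q j n :
  0 < j -> 2 * j <= q -> q.+1 ^ n <= 2 ^ (n %/ j).+1 * q ^ n.
Proof.
move=> j_gt0 le_jq.
have small p : p <= j -> q.+1 ^ p <= 2 * q ^ p.
  move=> le_pj; rewrite -(@leq_pmul2r q) ?(leq_trans _ le_jq) ?muln_gt0 //.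
  apply: (@leq_trans (q.+1 ^ p * (2 * (q - p)))); first by rewrite leq_mul2l; lia.
  by rewrite mulnCA -mulnA leq_mul2l -expnSr expnS_le_mul //; lia.
rewrite {1 3}(divn_eq n j); have := ltnW (ltn_pmod n j_gt0).
move: (n %% j) (n %/ j) => p m le_pj; elim: m => [|m IHm]; first exact: small.
rewrite mulSn -addnA ![_ ^ (j + _)]expnD expnS.
by have := leq_mul (small j (leqnn j)) IHm; lia.
Qed.

(** This is ['C(n, s) * x^s <= (1 + x)^n] at [x = 1/q], with denominators cleared. *)
Lemma bin_mul_exp q n s : 'C(n, s) * q ^ n <= q ^ s * q.+1 ^ n.
Proof.
elim: n s => [|n IHn] [|s].
- by [].
- by rewrite bin0n.
- by rewrite bin0 expn0 !mul1n leq_exp2r.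
have := IHn s.+1; have := IHn s; rewrite binS [q ^ s.+1]expnS [q ^ n.+1]expnS.
by rewrite [q.+1 ^ n.+1]expnS; nia.
Qed.

Lemma bin_le_exp2 n s : 'C(n, s) <= 2 ^ (4 * s + (n %/ 8).+1).
Proof.
rewrite -(@leq_pmul2r (16 ^ n)) ?expn_gt0 //.
apply: leq_trans (bin_mul_exp 16 n s) _.
by rewrite expnD expnM -mulnA leq_mul2l expnS_le_exp2 // orbT.
Qed.

(** With [s] near [t / 64] each binomial is at most [2 ^ (t %/ 4 + 1)], so their product is within a
    constant factor of the lower bound for [R(K_t)]; [200 <= t] leaves room for rounding. *)
Lemma bin_lt_exp2_half t s :
  200 <= t -> s = (t %/ 64).+1 ->
  2 * (t + 'C(t + s, s) * 'C(s + t.+1, s)) < 128 * 2 ^ (t./2).-1.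
Proof.
move=> le_t def_s; set r := t %/ 4.
have le_bin : 'C(s + t.+1, s) <= 2 ^ (r + 1).
  by apply: leq_trans (bin_le_exp2 _ _) _; rewrite leq_exp2l // /r; lia.
have le_bin2 : 'C(t + s, s) <= 2 ^ (r + 1).
  by apply: leq_trans le_bin; apply: leq_bin2l; lia.
have le_r : 2 ^ (r + 1) * 2 ^ (r + 1) <= 8 * 2 ^ (t./2).-1.
  by rewrite -expnD -[8]/(2 ^ 3) -expnD leq_exp2l // /r; lia.
have := leq_mul le_bin2 le_bin; have := ltn_expl (t./2).-1 (isT : 1 < 2).
by lia.
Qed.

(** * Consecutive Ramsey numbers of complete graphs *)

Lemma ramsey_complete_exp t : 4 <= t -> 2 ^ (t./2).-1 < ramsey_number (complete_graph t).
Proof.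
move=> le_t; apply: (@leq_trans (ramsey_number (complete_graph (2 * (t./2).-1).+2))).
  by apply: ramsey_complete_gt_expn; lia.
by apply: ramsey_complete_mono; lia.
Qed.

Lemma ramsey_complete_succ :
  exists C, forall t, 0 < t ->
    ramsey_number (complete_graph t.+1) <= C * ramsey_number (complete_graph t).
Proof.
(* Among [257 * d] vertices, some neighbourhood of a given vertex has at least [128 * d] elements;
   the second summand covers [t < 200]. *)
exists (257 + ramsey_number (complete_graph 200)) => t t_gt0.
set d := ramsey_number (complete_graph t).
have d_gt0 : 0 < d := leq_trans t_gt0 (ramsey_complete_ge t).
have [lt_t|le_t] := ltnP t 200.
  apply: leq_trans (ramsey_complete_mono lt_t) _.
  by apply: leq_trans (leq_pmulr _ d_gt0) _; rewrite leq_mul2r leq_addl orbT.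
apply: (@leq_trans (257 * d)); last by rewrite leq_mul2r leq_addr orbT.
apply/ramsey_number_le/arrow_has_clique => c c_sym; apply: NNPP => no_clique.
have no_cl b W : ~ has_clique c b W t.+1.
  by move=> cl; apply: no_clique; exists b; apply: has_cliqueS cl; rewrite ?subsetT.
have v_lt : 0 < 257 * d by lia.
pose v := Ordinal v_lt.
have [b le_A] : exists b, 128 * d <= #|nbhd c b v setT|.
  have := card_nbhd c true (in_setT v); rewrite cardsT card_ord /= => cardN.
  have [le_A|lt_A] := leqP (128 * d) #|nbhd c true v setT|; first by exists true.
  exists false; move: cardN lt_A.
  by move: #|nbhd c true v setT| #|nbhd c false v setT| => x y; lia.
set A := nbhd c b v setT in le_A.
have no_A : ~ has_clique c b A t.
  by move=> /(has_clique_nbhd c_sym (in_setT v)); apply: no_cl.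
have deg x : x \in A -> #|nbhd c (~~ b) x A| <= d.
  move=> Ax; rewrite leqNgt; apply/negP => /ltnW le_d.
  have [b' cl] := has_clique_arrow (ramsey_numberP (simple_complete t)) c_sym le_d.
  have [eq_b|ne_b] := eqVneq b' b.
    by apply: no_A; rewrite -eq_b; apply: has_cliqueS cl; rewrite ?nbhd_sub.
  have {}ne_b : b' = ~~ b by case: (b) (b') ne_b => -[].
  by rewrite ne_b in cl; apply/no_cl/(has_clique_nbhd c_sym Ax cl).
have := card_sparse_colour c_sym deg no_A (@no_cl _ _) (ltn0Sn (t %/ 64)).
have := bin_lt_exp2_half le_t erefl; have := ramsey_complete_exp (leq_trans (isT : 4 <= 200) le_t).
rewrite -/d => lt_d lt_s le_s.
(* The resulting bound on [#|A|] lies below [128 * 2 ^ (t./2).-1 < 128 * d], against [le_A]; the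
   value of [s] is chosen so that [2 * t <= 128 * s]. *)
suff /le_s : 2 * t * d <= (t %/ 64).+1 * #|A| by move: lt_d lt_s le_A; lia.
apply: (@leq_trans ((t %/ 64).+1 * (128 * d))); last by rewrite leq_mul2l le_A orbT.
by rewrite mulnA leq_mul2r; lia.
Qed.

(** * The graphs [G(t, n)] and their Ramsey numbers *)

(** This is [G(t, n)]; the star at vertex 0 makes it connected for every [t]. *)
Definition dominated_clique t n : rel 'I_n :=
  fun u v => (u != v) && [|| (u < t) && (v < t), u == 0 :> nat | v == 0 :> nat].

Lemma simple_dominated_clique t n : simple_graph (@dominated_clique t n).
Proof.
split=> [u v|u]; rewrite /dominated_clique ?eqxx //.
by rewrite eq_sym andbC [_ || (v == 0 :> nat)]orbC [(u < t) && _]andbC andbC.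
Qed.

Lemma connected_dominated_clique t n : connected_graph (@dominated_clique t n).
Proof.
case: n => [|n] u v; first by case: u.
have to0 x : connect (@dominated_clique t n.+1) x ord0.
  have [->|ne_x0] := eqVneq x ord0; first exact: connect0.
  by apply: connect1; rewrite /dominated_clique ne_x0 eqxx !orbT.
have from0 x : connect (@dominated_clique t n.+1) ord0 x.
  have [->|ne_x0] := eqVneq x ord0; first exact: connect0.
  by apply: connect1; rewrite /dominated_clique eq_sym ne_x0 eqxx !orbT.
exact: connect_trans (to0 u) (from0 v).
Qed.

Lemma dominated_cliqueW t n (le_tn : t <= n) (u v : 'I_t) :
  u != v -> dominated_clique t (widen_ord le_tn u) (widen_ord le_tn v).
Proof.
move=> ne_uv; rewrite /dominated_clique (inj_eq (@widen_ord_inj _ _ _)) ne_uv.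
by rewrite /= !ltn_ord.
Qed.

Lemma ramsey_dominated_clique_ge t n :
  t <= n -> ramsey_number (complete_graph t) <= ramsey_number (@dominated_clique t n).
Proof.
move=> le_tn; apply: ramsey_number_le.
apply: ramsey_arrow_sub (@widen_ord_inj _ _ le_tn) (@dominated_cliqueW _ _ le_tn) _.
exact/ramsey_numberP/simple_dominated_clique.
Qed.

(* Chvatal--Harary: t - 1 disjoint cliques of size n - 1 in one colour. *)
Lemma ramsey_dominated_clique_gt t n :
  1 < t -> t <= n -> t.-1 * n.-1 < ramsey_number (@dominated_clique t n).
Proof.
move=> t_gt1 le_tn; apply: ramsey_number_gt; first exact: simple_dominated_clique.
have n1_gt0 : 0 < n.-1 by lia.
apply/negP => /ramsey_arrowP/(_ (fun x y => x %/ n.-1 == y %/ n.-1)).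
case=> [x y|phi [inj_phi [[] mono_phi]]]; first exact: eq_sym.
  (* Inside the blocks: the star at vertex 0 forces all [n] vertices into one block, which has only
     [n - 1] elements. *)
  have n_gt0 : 0 < n by lia.
  have block u : phi u %/ n.-1 = phi (Ordinal n_gt0) %/ n.-1.
    have [->//|ne_u] := eqVneq u (Ordinal n_gt0).
    by apply/eqP/mono_phi; rewrite /dominated_clique ne_u eqxx !orbT.
  pose g u := Ordinal (ltn_pmod (phi u) n1_gt0).
  have inj_g : injective g.
    move=> u v /(congr1 val) /= eq_uv; apply/inj_phi/val_inj.
    by rewrite /= (divn_eq (phi u) n.-1) eq_uv block -(block v) -divn_eq.
  by have := leq_card g inj_g; rewrite !card_ord; lia.
(* Across the blocks: the [t] clique vertices would need distinct blocks, but there are only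
   [t - 1]. *)
have lt_block (u : 'I_t) : phi (widen_ord le_tn u) %/ n.-1 < t.-1.
  by rewrite ltn_divLR.
pose g u := Ordinal (lt_block u).
have inj_g : injective g.
  move=> u v /(congr1 val) /= eq_uv; apply/eqP/negPn/negP => ne_uv.
  by have := mono_phi _ _ (dominated_cliqueW le_tn ne_uv); rewrite eq_uv eqxx.
by have := leq_card g inj_g; rewrite !card_ord; lia.
Qed.

(** Each chosen vertex costs itself and fewer than [n] neighbours in the other colour, hence at most
    [n] vertices of [W]. *)
Lemma greedy_clique (V : finType) (c : V -> V -> bool) b (W : {set V}) t n :
  (forall x y, c x y = c y x) -> 0 < n ->
  (forall x, x \in W -> #|nbhd c (~~ b) x W| < n) -> t * n <= #|W| ->
  has_clique c b W t.
Proof.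
move=> c_sym n_gt0; elim: t W => [|t IHt] W deg le_W; first exact: has_clique0.
have [v Wv] : exists v, v \in W by apply/set0Pn; rewrite -card_gt0; lia.
apply: (has_clique_nbhd c_sym Wv); apply: IHt => [x /(subsetP (nbhd_sub _ _ _ _)) Wx|].
  by apply: leq_ltn_trans (deg x Wx); apply/subset_leq_card/nbhdS/nbhd_sub.
by have := card_nbhd c b Wv; have := deg v Wv; lia.
Qed.

Lemma dominated_clique_embedding t n (V : finType) (c : V -> V -> bool) b v (S : {set V}) :
  (forall x y, c x y = c y x) ->
  mono c b S -> t <= #|S| -> v \in S -> n.-1 <= #|nbhd c b v setT| ->
  exists phi : 'I_n -> V, injective phi /\
    forall u w, dominated_clique t u w -> c (phi u) (phi w) = b.
Proof.
move=> c_sym monoS le_tS Sv le_n.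
have sS : S :\ v \subset nbhd c b v setT.
  apply/subsetP => x /setD1P[ne_xv Sx]; rewrite !inE ne_xv; apply/eqP/monoS => //.
  by rewrite eq_sym.
(* Vertex [u] is sent to entry [u] of [v :: L]: vertex 0 goes to the centre [v], and those below [t]
   stay in [S] because [S] is listed first. *)
pose L := enum (S :\ v) ++ enum (nbhd c b v setT :\: S).
have memL x : x \in L -> x \in nbhd c b v setT.
  by rewrite mem_cat !mem_enum => /orP[/(subsetP sS) | /setDP[]].
have uniqL : uniq (v :: L).
  rewrite /= cat_uniq !enum_uniq /= andbT; apply/andP; split.
    by apply/negP => /memL; rewrite !inE eqxx.
  by apply/hasPn => x; rewrite /= !mem_enum !inE => /andP[/negPf ->]; rewrite andbF.
have sizeL : n <= size (v :: L).
  have -> : size (v :: L) = #|nbhd c b v setT|.+1.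
    rewrite /= size_cat -!cardE -(cardsID S (nbhd c b v setT)); congr (_ + _).+1.
    apply: eq_card => x; rewrite [in RHS]inE; apply/idP/andP => [Sx|[]].
      by rewrite (subsetP sS) //; case/setD1P: Sx.
    by rewrite !inE => /and3P[_ -> _].
  by apply: leq_trans (leqSpred n) _; rewrite ltnS.
have lt_size (u : 'I_n) : u < size (v :: L) := leq_trans (ltn_ord u) sizeL.
pose phi (u : 'I_n) := nth v (v :: L) u.
have phi0 (u : 'I_n) : u = 0 :> nat -> phi u = v by rewrite /phi => ->.
have phi_nbhd (u : 'I_n) : u != 0 :> nat -> phi u \in nbhd c b v setT.
  move=> u_neq0; apply: memL; rewrite /phi -(prednK (n := u)) ?lt0n //= mem_nth //.
  by have := lt_size u; rewrite /= ; lia.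
have phi_S (u : 'I_n) : u < t -> phi u \in S.
  move=> lt_ut; have [/phi0-> //|u_neq0] := eqVneq (u : nat) 0.
  have lt_u : u.-1 < size (enum (S :\ v)).
    by rewrite -cardE; have := cardsD1 v S; rewrite Sv; lia.
  have : phi u \in enum (S :\ v).
    by rewrite /phi -(prednK (n := u)) ?lt0n //= nth_cat lt_u mem_nth.
  by rewrite mem_enum => /setD1P[].
have inj_phi : injective phi.
  by move=> u w /eqP; rewrite nth_uniq // => /eqP; apply: val_inj.
have phi_v (u : 'I_n) : u != 0 :> nat -> c v (phi u) = b.
  by move/phi_nbhd; rewrite !inE /= => /andP[_ /eqP].
exists phi; split=> // u w /andP[ne_uw].
have ne_uw' : (u : nat) != w by [].
case/or3P => [/andP[lt_u lt_w] | /eqP u0 | /eqP w0].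
- by apply: monoS; rewrite ?phi_S // (inj_eq inj_phi).
- by rewrite (phi0 u u0) phi_v //; move: ne_uw'; rewrite u0 eq_sym.
- by rewrite c_sym (phi0 w w0) phi_v //; move: ne_uw'; rewrite w0.
Qed.

(* Vertices of degree below n - 1 in a colour span a graph in which the other
   colour contains greedy cliques; the remaining vertices can serve as the
   centre of a star of either colour. *)
Lemma ramsey_dominated_clique_le t n :
  0 < t -> t <= n ->
  ramsey_number (@dominated_clique t n) <= ramsey_number (complete_graph t) + 2 * (t * n).
Proof.
move=> t_gt0 le_tn; apply/ramsey_number_le/ramsey_arrowP => c c_sym.
have n_gt0 : 0 < n := leq_trans t_gt0 le_tn.
set N := ramsey_number _ + _ in c c_sym *.
have defN : N = ramsey_number (complete_graph t) + 2 * (t * n) by [].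
have le_N : 2 * n <= N by rewrite defN; nia.
suff [b [S [v [monoS le_tS Sv le_n]]]] : exists b S v,
    [/\ mono c b S, t <= #|S|, v \in S & n.-1 <= #|nbhd c b v setT|].
  have [phi [inj_phi mono_phi]] := dominated_clique_embedding c_sym monoS le_tS Sv le_n.
  by exists phi; split=> //; exists b.
pose low b := [set x | #|nbhd c b x setT| < n.-1].
have low_clique b : t * n <= #|low b| -> exists b S v,
    [/\ mono c b S, t <= #|S|, v \in S & n.-1 <= #|nbhd c b v setT|].
  move=> le_low; have [||S [sS le_tS monoS]] := @greedy_clique _ c (~~ b) (low b) t n c_sym n_gt0.
  - move=> x; rewrite inE negbK => lt_x; apply: leq_ltn_trans (leq_trans lt_x (leq_pred n)).
    exact/subset_leq_card/nbhdS/subsetT.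
  - exact: le_low.
  have [v Sv] : exists v, v \in S by apply/set0Pn; rewrite -card_gt0; lia.
  (* As [2 * n <= N], a vertex of degree below [n - 1] in colour [b] has degree at least [n - 1] in
     the other colour. *)
  exists (~~ b), S, v; split=> //; have := subsetP sS v Sv; rewrite inE.
  have := card_nbhd c b (in_setT v); rewrite cardsT card_ord.
  by move: #|nbhd c b v setT| #|nbhd c (~~ b) v setT| => x y; lia.
have [/low_clique //|lt_true] := leqP (t * n) #|low true|.
have [/low_clique //|lt_false] := leqP (t * n) #|low false|.
have le_rest : ramsey_number (complete_graph t) <= #|~: (low true :|: low false)|.
  have := cardsC (low true :|: low false); rewrite card_ord.
  have := (leq_card_setU (low true) (low false)).1; move: lt_true lt_false defN.
  by move: #|low true| #|low false| #|~: _| #|_ :|: _| => x y z u; lia.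
have [b [S [sS le_tS monoS]]] :=
  has_clique_arrow (ramsey_numberP (simple_complete t)) c_sym le_rest.
have [v Sv] : exists v, v \in S by apply/set0Pn; rewrite -card_gt0; lia.
exists b, S, v; split=> //; have := subsetP sS v Sv; rewrite !inE negb_or -!leqNgt.
by case: b {monoS} => /andP[].
Qed.

Lemma chromatic_dominated_clique t n :
  t <= n -> t <= chromatic_number (@dominated_clique t n).
Proof.
move=> le_tn; have [|/existsP[col /forallP proper] _] :=
  @min_natP (colourable (@dominated_clique t n)) n.
  (* The identity is a proper colouring with [n] colours, which excludes the default value 0 of
     [min_nat]. *)
  apply/existsP; exists (finfun id); apply/forallP => u; apply/forallP => v.
  by apply/implyP => /andP[]; rewrite !ffunE.
pose g u := col (widen_ord le_tn u).
have inj_g : injective g.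
  move=> u v eq_uv; apply/eqP/negPn/negP => /(dominated_cliqueW le_tn) adj.
  by have /forallP/(_ (widen_ord le_tn v)) := proper (widen_ord le_tn u);
     rewrite adj -/(g u) eq_uv eqxx.
by have := leq_card g inj_g; rewrite !card_ord.
Qed.

(** * Interpolation between [n] and [R(K_n)] *)

(** The two terms of the upper bound at [t + 1] are compared with the two lower bounds at [t]; 12
    comes from [t + 1 <= 3 * (t - 1)] and [n <= 2 * (n - 1)]. *)
Lemma ramsey_dominated_clique_succ :
  exists C, forall t n, 1 < t -> t < n ->
    ramsey_number (@dominated_clique t.+1 n) <= C * ramsey_number (@dominated_clique t n).
Proof.
have [C le_C] := ramsey_complete_succ; exists (C + 12) => t n t_gt1 lt_tn.
have t_gt0 := ltnW t_gt1.
apply: leq_trans (ramsey_dominated_clique_le (ltn0Sn t) lt_tn) _.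
rewrite mulnDl leq_add //.
  by apply: leq_trans (le_C t t_gt0) _; rewrite leq_mul2l ramsey_dominated_clique_ge ?orbT // ltnW.
apply: (@leq_trans (12 * (t.-1 * n.-1))).
  by nia.
by rewrite leq_mul2l /= ltnW // ramsey_dominated_clique_gt // ltnW.
Qed.

(** The largest [t] with [R(G(t, n)) <= m] works, since the next value exceeds [m] by a bounded
    factor at most. *)
Lemma interpolate_dominated_clique k :
  1 < k -> exists C, forall n m, k <= n -> n <= m ->
    m <= ramsey_number (complete_graph n) ->
    exists t, [/\ k <= t, t <= n, m <= C * ramsey_number (@dominated_clique t n) &
      ramsey_number (@dominated_clique t n) <= C * m].
Proof.
move=> k_gt1; have [C le_C] := ramsey_dominated_clique_succ.
have k_gt0 := ltnW k_gt1.
exists (C + ramsey_number (complete_graph k) + 2 * k).+1 => n m le_kn le_nm le_m.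
set C' := (_.+1); pose r t := ramsey_number (@dominated_clique t n).
have le_C' x : x <= C' * x by rewrite leq_pmull.
(* If [m] is at most the value at [t = k], that value is still at most [R(K_k) + 2 * k * n], and
   [n <= m]. *)
have [le_mr|lt_rm] := leqP m (r k).
  exists k; split=> //; first by apply: leq_trans le_mr (le_C' _).
  apply: leq_trans (ramsey_dominated_clique_le k_gt0 le_kn) _.
  by rewrite /C'; move: (ramsey_number _) => rk; nia.
have exP : exists t, [&& k <= t, t <= n & r t <= m] by exists k; rewrite leqnn le_kn ltnW.
have ubP t : [&& k <= t, t <= n & r t <= m] -> t <= n by case/and3P.
case: (ex_maxnP exP ubP) => t /and3P[le_kt le_tn le_rt] max_t.
exists t; split=> //; last exact: leq_trans le_rt (le_C' _).
have [eq_tn|ne_tn] := eqVneq t n.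
  rewrite -eq_tn in le_m *; apply: leq_trans (le_C' _); apply: leq_trans le_m _.
  exact: ramsey_dominated_clique_ge.
have lt_tn : t < n by rewrite ltn_neqAle ne_tn.
have lt_mr : m < r t.+1.
  rewrite ltnNge; apply/negP => le_rm; have /max_t : [&& k <= t.+1, t.+1 <= n & r t.+1 <= m].
    by rewrite le_rm lt_tn leqW.
  by rewrite ltnn.
apply: leq_trans (ltnW lt_mr) _.
apply: leq_trans (le_C t n (leq_trans k_gt1 le_kt) lt_tn) _.
by rewrite leq_mul2r /C' -addnA leqW ?leq_addr ?orbT.
Qed.

Theorem theorem5p2 :
  forall k : nat, (2 <= k)%N ->
  exists (c C : R) (n0 : nat), Rlt 0 c /\ Rlt 0 C /\
    forall f : nat -> nat,
      (forall m n, (m <= n)%N -> (f m <= f n)%N) ->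
      (forall n, (n <= f n)%N /\ (f n <= ramsey_number (complete_graph n))%N) ->
      exists G : forall n : nat, rel 'I_n,
        (forall n, simple_graph (G n)) /\
        (forall n, connected_graph (G n)) /\
        (forall n, Rle (Rmult c (INR (f n))) (INR (ramsey_number (G n))) /\
                   Rle (INR (ramsey_number (G n))) (Rmult C (INR (f n)))) /\
        (forall n, (n0 <= n)%N -> (k <= chromatic_number (G n))%N).
Proof.
move=> k k_gt1; have [C0 interp] := interpolate_dominated_clique k_gt1.
(* The summand [R(K_k)] serves [n < k], where the graph is [K_n] itself and its Ramsey number is at
   most [R(K_k)]. *)
pose C := (C0 + ramsey_number (complete_graph k)).+1.
have C_gt0 : Rlt 0 (INR C) by apply: lt_0_INR; apply/ltP.
exists (Rinv (INR C)), (INR C), k; split; first exact: Rinv_0_lt_compat.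
split=> // f _ f_bnd.
have tP n : exists t, [/\ f n <= C * ramsey_number (@dominated_clique t n),
    ramsey_number (@dominated_clique t n) <= C * f n & k <= n -> k <= t <= n].
  have [le_nf le_fR] := f_bnd n.
  have [le_kn|lt_nk] := leqP k n.
    have [t [le_kt le_tn le_f le_R]] := interp n (f n) le_kn le_nf le_fR.
    by exists t; split; rewrite ?le_kt //; [apply: leq_trans le_f _ | apply: leq_trans le_R _];
       rewrite leq_mul2r /C leqW ?leq_addr ?orbT.
  have eqR : ramsey_number (@dominated_clique n n) <= ramsey_number (complete_graph n).
    apply/ramsey_number_le/simple_graph_arrow; first exact: simple_dominated_clique.
    exact/ramsey_numberP/simple_complete.
  exists n; split=> //.
    apply: leq_trans le_fR _; apply: leq_trans (ramsey_dominated_clique_ge (leqnn n)) _.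
    by rewrite leq_pmull.
  apply: leq_trans eqR _; case: n lt_nk le_nf {le_fR} => [|n] lt_nk le_nf.
    (* For [n = 0] the value [f 0] is 0, so no constant helps: the Ramsey number itself has to be
       0. *)
    rewrite (@leq_trans 0) //; apply/ramsey_number_le/arrow_has_clique => c _.
    by exists true; apply: has_clique0.
  apply: leq_trans (ramsey_complete_mono (ltnW lt_nk)) _.
  by rewrite /C; move: (ramsey_number _) => rk; nia.
have [t t_spec] : exists t : nat -> nat, forall n, [/\
    f n <= C * ramsey_number (@dominated_clique (t n) n),
    ramsey_number (@dominated_clique (t n) n) <= C * f n & k <= n -> k <= t n <= n].
  exists (fun n => proj1_sig (constructive_indefinite_description _ (tP n))) => n.
  exact: proj2_sig (constructive_indefinite_description _ (tP n)).
exists (fun n => @dominated_clique (t n) n); split.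
  by move=> n; apply: simple_dominated_clique.
split; first by move=> n; apply: connected_dominated_clique.
split=> [n | n le_kn].
  have [le_f le_R _] := t_spec n; split.
    rewrite -(Rmult_1_l (INR (ramsey_number _))) -(Rinv_l (INR C)); last exact: Rgt_not_eq.
    rewrite Rmult_assoc -mult_INR; apply: Rmult_le_compat_l.
      exact/Rlt_le/Rinv_0_lt_compat.
    exact/le_INR/leP.
  by rewrite -mult_INR; apply/le_INR/leP.
have [_ _ /(_ le_kn)/andP[le_kt le_tn]] := t_spec n.
exact: leq_trans le_kt (chromatic_dominated_clique le_tn).
Qed.
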